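(* Let $V=\mathbb{C}(\!(z)\!)[\theta]$ with $z$ even and $\theta$ odd, let $\Omega_V$ be its module of Kähler differentials (the free $V$-module on $dz,d\theta$), let $a\in\mathbb{Z}$, $\varpi=dz-d\theta\,z^a\theta\in\Omega_V$, and $Q=\Omega_V/(\varpi)$, with $[\cdot]:\Omega_V\to Q$ the quotient map. Then there is an exact sequence $$0\to\mathbb{C}\to V\xrightarrow{[d]}Q\xrightarrow{\operatorname{Res}}\mathbb{C}\to0 .$$ Moreover the image $Q':=\operatorname{im}[d]\subset Q$, i.e. the space of residueless elements, admits a super symplectic form (a well-defined, super antisymmetric, non-degenerate bilinear pairing) defined by $$\langle[df],[dg]\rangle=\operatorname*{Res}_{z=0}\,[df\cdot g],\qquad f,g\in V.$$
   Context: Super degree and cohomological degree give independent signs, so $dz\,\theta=\theta\,dz$ and $d\theta\,\theta=-\theta\,d\theta$. The differential is $df=dz\,\partial_zf+d\theta\,\partial_\theta f$, and $[d]f:=[df]$. In $Q$ one has $[dz]=[d\theta]z^a\theta$ and $[dz]\theta=0$, so every element of $Q$ is uniquely of the form $\sum_k\big([dz]z^ku_k+[d\theta]z^k\upsilon_k\big)$ with $u_k,\upsilon_k\in\mathbb{C}$ vanishing for $k\ll0$; its residue is $\operatorname{Res}=u_{-1}$. Super antisymmetric means $\langle X,Y\rangle=-(-1)^{|X||Y|}\langle Y,X\rangle$ for homogeneous $X,Y$. *)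

(* Defs.v *)
From HB Require Import structures.
From mathcomp Require Import all_boot all_order all_algebra.
From mathcomp Require Import all_classical.
From mathcomp Require Import zify ring.

Set Implicit Arguments.
Unset Strict Implicit.
Unset Printing Implicit Defensive.

Import Order.TTheory GRing.Theory Num.Theory.

Local Open Scope classical_set_scope.
Local Open Scope ring_scope.

Section Laurent.
Variable F : fieldType.

(* F((z)): families of coefficients (u_k) over k in Z vanishing for k << 0. *)
Definition bounded_below : {pred int -> F^o} :=
  fun u => `[< exists m : int, forall k, (k < m)%R -> u k = 0 >].

Lemma bounded_belowP (u : int -> F^o) :
  reflect (exists m : int, forall k, (k < m)%R -> u k = 0)
          (u \in bounded_below).
Proof. exact: asboolP. Qed.

Fact bounded_below_submod : submod_closed bounded_below.
Proof.
split=> [|c u v /bounded_belowP[m hu] /bounded_belowP[n hv]].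
  by apply/bounded_belowP; exists 0.
apply/bounded_belowP; exists (Num.min m n) => k; rewrite lt_min => /andP[km kn].
have -> : (c *: u + v) k = c *: u k + v k by [].
by rewrite hu // hv // scaler0 addr0.
Qed.
HB.instance Definition _ :=
  GRing.isSubmodClosed.Build F (int -> F^o) bounded_below bounded_below_submod.

Record laurent := Laurent {
  coefL :> int -> F^o;
  _ : coefL \in bounded_below }.

HB.instance Definition _ := [isSub for coefL].
HB.instance Definition _ := [Choice of laurent by <:].
HB.instance Definition _ := [SubChoice_isSubLmodule of laurent by <:].

Lemma laurentP (u v : laurent) : (forall k, u k = v k) <-> u = v.
Proof. by split=> [uv|->//]; apply/val_inj/funext. Qed.

Lemma coefLD (u v : laurent) k : (u + v) k = u k + v k. Proof. by []. Qed.
Lemma coefL0 k : (0 : laurent) k = 0. Proof. by []. Qed.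
Lemma coefLN (u : laurent) k : (- u) k = - u k. Proof. by []. Qed.
Lemma coefLZ c (u : laurent) k : (c *: u) k = c * u k. Proof. by []. Qed.

Lemma laurent_bound (u : laurent) :
  exists m : int, forall k, (k < m)%R -> u k = 0.
Proof. exact/bounded_belowP/(valP u). Qed.

(* Finitely supported sum, since u and v are bounded below. *)
Definition convol (u v : laurent) : int -> F^o :=
  fun n => \sum_(i \in [set: int]) (u i * v (n - i) : F).

Definition window (m : int) (N : nat) : seq int :=
  [seq m + k%:Z | k <- iota 0 N].

Lemma window_uniq m N : uniq (window m N).
Proof. by rewrite map_inj_uniq ?iota_uniq // => i j /addrI[]. Qed.

Lemma mem_window m N i : (i \in window m N) = (m <= i < m + N%:Z)%R.
Proof.
apply/mapP/andP => [[k]|[mi iN]]; first by rewrite mem_iota => kN ->; lia.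
by exists `|i - m|%N; [rewrite mem_iota|]; lia.
Qed.

Lemma sum_window (f : int -> F) m N :
    (forall i, (i < m)%R -> f i = 0) ->
    (forall i, (m + N%:Z <= i)%R -> f i = 0) ->
  \sum_(i \in [set: int]) f i = \sum_(i <- window m N) f i.
Proof.
move=> f0 f1; rewrite [RHS]fsbig_seq ?window_uniq //.
apply/esym/fsbig_widen => // i [_ /= /negP]; rewrite mem_window negb_and.
by rewrite -ltNge -leNgt => /orP[/f0|/f1].
Qed.

Lemma convol_lt (u v : laurent) (m n : int) :
    (forall k, (k < m)%R -> u k = 0) -> (forall k, (k < n)%R -> v k = 0) ->
  forall k, (k < m + n)%R -> convol u v k = 0.
Proof.
move=> hu hv k kmn; rewrite /convol (@sum_window _ m 0%N) ?big_nil // => i hi.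
  by rewrite hu ?mul0r.
by rewrite [v _]hv ?mulr0 //; lia.
Qed.

Fact convol_subproof (u v : laurent) : convol u v \in bounded_below.
Proof.
have [m hu] := laurent_bound u; have [n hv] := laurent_bound v.
by apply/bounded_belowP; exists (m + n); exact: convol_lt.
Qed.
Definition mulL u v : laurent := Laurent (convol_subproof u v).

Fact mulLC : commutative mulL.
Proof.
move=> u v; apply/laurentP => n /=; rewrite /convol.
rewrite (reindex_fsbigT (fun i : int => n - i)); last first.
  by exists (fun i => n - i) => i; lia.
by apply: eq_fsbigr => i _; rewrite mulrC; congr (v _ * u _); lia.
Qed.

Fact mulLDl : left_distributive mulL +%R.
Proof.
move=> u v w; have [mu hu] := laurent_bound u; have [mv hv] := laurent_bound v.
have [mw hw] := laurent_bound w; apply/laurentP => n; rewrite coefLD /= /convol.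
have [m [mmu mmv]] : exists m : int, (m <= mu)%R /\ (m <= mv)%R.
  by exists (- (`|mu| + `|mv|)%N%:Z); lia.
have [N hN] : exists N : nat, (n < m + N%:Z + mw)%R.
  by exists (`|n| + `|m| + `|mw|).+1; lia.
have w0 i : (m + N%:Z <= i)%R -> w (n - i) = 0 by move=> hi; apply: hw; lia.
have sumE (x : laurent) : (forall i, (i < m)%R -> x i = 0) ->
    \sum_(i \in [set: int]) (x i * w (n - i) : F) =
    \sum_(i <- window m N) x i * w (n - i).
  move=> hx; apply: sum_window => i hi; first by rewrite hx ?mul0r.
  by rewrite [w _]w0 ?mulr0.
have hu' i : (i < m)%R -> u i = 0 by move=> hi; apply: hu; lia.
have hv' i : (i < m)%R -> v i = 0 by move=> hi; apply: hv; lia.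
have huv' i : (i < m)%R -> (u + v) i = 0.
  by move=> hi; rewrite coefLD hu' // hv' // addr0.
rewrite !sumE // -big_split /=.
by apply: eq_bigr => i _; rewrite mulrDl.
Qed.

Fact mulLA : associative mulL.
Proof.
move=> u v w; have [mu hu] := laurent_bound u; have [mv hv] := laurent_bound v.
have [mw hw] := laurent_bound w; apply/laurentP => n /=.
have [m [mmu mmuv]] : exists m : int, (m <= mu)%R /\ (m <= mu + mv)%R.
  by exists (- (`|mu| + `|mv|)%N%:Z); lia.
have [N [hN hN']] : exists N : nat,
    (n - mw < m + N%:Z)%R /\ (n - mv - mw < m + N%:Z)%R.
  by exists (`|n| + `|m| + `|mv| + `|mw|).+1; lia.
have lhs : convol u (mulL v w) n =
    \sum_(i <- window m N) \sum_(j <- window m N) u i * (v (j - i) * w (n - j)).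
  rewrite /convol (@sum_window _ m N) => [|i hi|i hi]; first last.
  - by rewrite [mulL v w _](convol_lt hv hw) ?mulr0 //; lia.
  - by rewrite hu ?mul0r //; lia.
  apply: eq_bigr => i _; have [imu|imu] := ltP i mu.
    by rewrite hu // mul0r big1 // => j _; rewrite mul0r.
  rewrite -mulr_sumr; congr (_ * _); rewrite /= /convol.
  rewrite (reindex_fsbigT (fun j : int => j - i)); last first.
    by exists (fun j => j + i) => j; lia.
  rewrite (@sum_window _ m N) => [|j hj|j hj]; first last.
  - by rewrite [w _]hw ?mulr0 //; lia.
  - by rewrite hv ?mul0r //; lia.
  by apply: eq_bigr => j _; congr (_ * w _); lia.
rewrite lhs exchange_big /convol (@sum_window _ m N) => [|j hj|j hj]; first last.
- by rewrite [w _]hw ?mulr0 //; lia.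
- by rewrite [mulL u v _](convol_lt hu hv) ?mul0r //; lia.
apply: eq_bigr => j _; have [jn|jn] := ltP (n - mw) j.
  rewrite [w _]hw ?mulr0 ?big1 // => [i _|]; last by lia.
  by rewrite !mulr0.
rewrite /= /convol (@sum_window _ m N) => [|i hi|i hi].
- by rewrite mulr_suml; apply: eq_bigr => i _; rewrite mulrA.
- by rewrite hu ?mul0r //; lia.
- by rewrite [v _]hv ?mulr0 //; lia.
Qed.

Fact zpow_subproof (k : int) :
  (fun n : int => (n == k)%:R : F^o) \in bounded_below.
Proof. by apply/bounded_belowP; exists k => n; case: eqP => // ->; lia. Qed.
Definition zpow (k : int) : laurent := Laurent (zpow_subproof k).

Lemma coef_zpowM k (u : laurent) n : mulL (zpow k) u n = u (n - k).
Proof.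
rewrite /= /convol (@sum_window _ k 1%N) => [|i hi|i hi].
- by rewrite big_cons big_nil /= !addr0 eqxx mul1r.
- by rewrite /= (_ : i == k = false) ?mul0r //; lia.
- by rewrite /= (_ : i == k = false) ?mul0r //; lia.
Qed.

Fact mul1L : left_id (zpow 0) mulL.
Proof. by move=> u; apply/laurentP => n; rewrite coef_zpowM subr0. Qed.

Fact oneL_neq0 : zpow 0 != 0 :> laurent.
Proof.
by apply/eqP => /laurentP/(_ 0)/eqP /=; rewrite oner_eq0.
Qed.

HB.instance Definition _ := GRing.Zmodule_isComNzRing.Build laurent
  mulLA mulLC mul1L mulLDl oneL_neq0.

Fact scalerLAl (c : F) (u v : laurent) : c *: (u * v) = (c *: u) * v.
Proof.
apply/laurentP => n; rewrite coefLZ /= /convol mulr_fsumr.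
by apply: eq_fsbigr => i _; rewrite mulrA.
Qed.
HB.instance Definition _ := GRing.Lmodule_isLalgebra.Build F laurent scalerLAl.

Lemma coef_mul_zpow k (u : laurent) n : (zpow k * u) n = u (n - k).
Proof. exact: coef_zpowM. Qed.

Lemma zpowD (k l : int) : zpow (k + l) = zpow k * zpow l.
Proof.
apply/laurentP => n; rewrite coef_mul_zpow /=; congr (nat_of_bool _)%:R.
by apply/eqP/eqP; lia.
Qed.

Fact derivL_subproof (u : laurent) :
  (fun k => (k + 1)%:~R * u (k + 1) : F^o) \in bounded_below.
Proof.
have [m hu] := laurent_bound u; apply/bounded_belowP; exists (m - 1) => k hk.
by rewrite [u _]hu ?mulr0 //; lia.
Qed.
Definition derivL (u : laurent) : laurent := Laurent (derivL_subproof u).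

Fact derivL_is_linear : linear derivL.
Proof.
by move=> c u v; apply/laurentP => k /=; rewrite mulrDr mulrCA.
Qed.
HB.instance Definition _ :=
  GRing.isLinear.Build F laurent laurent _ derivL derivL_is_linear.

End Laurent.

Section SuperLaurent.
Variable F : fieldType.
Local Notation K := (laurent F).

(* SuperLaurent f0 f1 is f0 + theta f1. *)
Record superlaurent := SuperLaurent { even_part : K; odd_part : K }.

Local Notation V := superlaurent.

Lemma eq_superlaurent (f g : V) :
  even_part f = even_part g -> odd_part f = odd_part g -> f = g.
Proof. by case: f g => [f0 f1] [g0 g1] /= -> ->. Qed.

Definition pair_of_superlaurent (f : V) := (even_part f, odd_part f).
Definition superlaurent_of_pair (p : K * K) := SuperLaurent p.1 p.2.
Fact pair_of_superlaurentK : cancel pair_of_superlaurent superlaurent_of_pair.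
Proof. by case. Qed.
HB.instance Definition _ := Choice.copy V (can_type pair_of_superlaurentK).

Definition addS (f g : V) :=
  SuperLaurent (even_part f + even_part g) (odd_part f + odd_part g).
Definition oppS (f : V) := SuperLaurent (- even_part f) (- odd_part f).
Definition scaleS (c : F) (f : V) :=
  SuperLaurent (c *: even_part f) (c *: odd_part f).
Definition mulS (f g : V) :=
  SuperLaurent (even_part f * even_part g)
               (even_part f * odd_part g + odd_part f * even_part g).

Fact addSA : associative addS.
Proof. by move=> f g h; apply: eq_superlaurent; exact: addrA. Qed.
Fact addSC : commutative addS.
Proof. by move=> f g; apply: eq_superlaurent; exact: addrC. Qed.
Fact add0S : left_id (SuperLaurent 0 0) addS.
Proof. by move=> f; apply: eq_superlaurent; exact: add0r. Qed.
Fact addNS : left_inverse (SuperLaurent 0 0) oppS addS.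
Proof. by move=> f; apply: eq_superlaurent; exact: addNr. Qed.
HB.instance Definition _ := GRing.isZmodule.Build V addSA addSC add0S addNS.

Fact scaleSA c d f : scaleS c (scaleS d f) = scaleS (c * d) f.
Proof. by apply: eq_superlaurent; exact: scalerA. Qed.
Fact scale1S : left_id 1 scaleS.
Proof. by move=> f; apply: eq_superlaurent; exact: scale1r. Qed.
Fact scaleSDr : right_distributive scaleS +%R.
Proof. by move=> c f g; apply: eq_superlaurent; exact: scalerDr. Qed.
Fact scaleSDl f : {morph scaleS^~ f : c d / c + d}.
Proof. by move=> c d; apply: eq_superlaurent; exact: scalerDl. Qed.
HB.instance Definition _ :=
  GRing.Zmodule_isLmodule.Build F V scaleSA scale1S scaleSDr scaleSDl.

Fact mulSA : associative mulS.
Proof. by move=> f g h; apply: eq_superlaurent; rewrite /=; ring. Qed.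
Fact mulSC : commutative mulS.
Proof. by move=> f g; apply: eq_superlaurent; rewrite /=; ring. Qed.
Fact mul1S : left_id (SuperLaurent 1 0) mulS.
Proof. by move=> f; apply: eq_superlaurent; rewrite /=; ring. Qed.
Fact mulSDl : left_distributive mulS +%R.
Proof. by move=> f g h; apply: eq_superlaurent; rewrite /=; ring. Qed.
Fact oneS_neq0 : SuperLaurent 1 0 != 0.
Proof. by apply/eqP => /(congr1 even_part)/eqP; rewrite oner_eq0. Qed.

(* theta is the only odd generator, so this supercommutative ring is
   commutative; the signs appear in its module of differentials. *)
HB.instance Definition _ := GRing.Zmodule_isComNzRing.Build V
  mulSA mulSC mul1S mulSDl oneS_neq0.

Fact scalerSAl (c : F) (f g : V) : c *: (f * g) = (c *: f) * g.
Proof. by apply: eq_superlaurent; rewrite /= ?scalerDr !scalerAl // scalerAr. Qed.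
HB.instance Definition _ := GRing.Lmodule_isLalgebra.Build F V scalerSAl.
Fact scalerSAr (c : F) (f g : V) : c *: (f * g) = f * (c *: g).
Proof. by rewrite mulrC scalerAl mulrC. Qed.
HB.instance Definition _ := GRing.Lalgebra_isAlgebra.Build F V scalerSAr.

Definition evenS (u : K) : V := SuperLaurent u 0.
Definition theta : V := SuperLaurent 0 1.

Definition constS (c : F^o) : V := c%:A.

Fact constS_is_linear : linear constS.
Proof. by move=> c d e; rewrite /constS scalerDl scalerA. Qed.
HB.instance Definition _ :=
  GRing.isLinear.Build F F^o V _ constS constS_is_linear.

(* false is the even parity, true the odd one *)
Definition has_parityS (p : bool) (f : V) : Prop :=
  (if p then even_part f else odd_part f) = 0.

Definition d_z (f : V) : V :=
  SuperLaurent (derivL (even_part f)) (derivL (odd_part f)).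

(* Left derivative: theta f1 |-> f1. *)
Definition d_theta (f : V) : V := evenS (odd_part f).

(* (f, g) is dz f + dtheta g, with coefficients on the right. *)
Definition kahler : Type := (V * V)%type.

HB.instance Definition _ := GRing.Lmodule.on kahler.

Lemma eq_kahler (w w' : kahler) : w.1 = w'.1 -> w.2 = w'.2 -> w = w'.
Proof. by case: w w' => [f g] [f' g'] /= -> ->. Qed.

Definition dz : kahler := (1, 0).
Definition dtheta : kahler := (0, 1).

Definition rmulO (w : kahler) (f : V) : kahler := (w.1 * f, w.2 * f).

(* f w = w f up to the sign picked up by the odd part of f at dtheta. *)
Definition lmulO (f : V) (w : kahler) : kahler :=
  (f * w.1, SuperLaurent (even_part f) (- odd_part f) * w.2).

(* dz is even and dtheta is odd. *)
Definition has_parityO (p : bool) (w : kahler) : Prop :=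
  has_parityS p w.1 /\ has_parityS (~~ p) w.2.

Definition diff (f : V) : kahler := rmulO dz (d_z f) + rmulO dtheta (d_theta f).

Lemma lmulO_dz : rmulO dz theta = lmulO theta dz.
Proof. by apply: eq_kahler; rewrite /= ?mulr0 ?mul0r ?mulr1 ?mul1r. Qed.

Lemma lmulO_dtheta : rmulO dtheta theta = - lmulO theta dtheta.
Proof.
apply: eq_kahler; rewrite /= ?mulr0 ?mul0r ?oppr0 // mulr1 mul1r.
by apply: eq_superlaurent; rewrite /= ?oppr0 ?opprK.
Qed.

Lemma rmulO_is_linear w : linear (rmulO w).
Proof. by move=> c f g; apply: eq_kahler; rewrite /= mulrDr scalerAr. Qed.

Fact diff_is_linear : linear diff.
Proof.
move=> c f g; apply: eq_kahler; rewrite /= !mul1r !mul0r ?addr0 ?add0r.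
  by apply: eq_superlaurent; rewrite /= linearP.
by apply: eq_superlaurent; rewrite /= ?scaler0 ?addr0.
Qed.
HB.instance Definition _ :=
  GRing.isLinear.Build F V kahler _ diff diff_is_linear.

Section Quotient.
Variable a : int.

Definition varpi : kahler := dz - rmulO dtheta (evenS (zpow F a) * theta).

(* Since varpi is even, its left and right multiples agree. *)
Lemma lmul_varpi f : lmulO f varpi = rmulO varpi f.
Proof.
by apply: eq_kahler; apply: eq_superlaurent; rewrite /=; ring.
Qed.

Definition varpi_submod : {pred kahler} :=
  fun w => `[< exists f, w = rmulO varpi f >].

Lemma varpi_submodP w :
  reflect (exists f, w = rmulO varpi f) (w \in varpi_submod).
Proof. exact: asboolP. Qed.

Fact varpi_submod_closed : submod_closed varpi_submod.
Proof.
split; first by apply/varpi_submodP; exists 0; apply: eq_kahler; rewrite /= mulr0.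
move=> c u v /varpi_submodP[f ->] /varpi_submodP[g ->].
by apply/varpi_submodP; exists (c *: f + g); rewrite rmulO_is_linear.
Qed.
HB.instance Definition _ :=
  GRing.isSubmodClosed.Build F kahler varpi_submod varpi_submod_closed.

Definition Q : Type := Quotient.quot varpi_submod.

HB.instance Definition _ := GRing.Zmodule.on Q.

Definition classQ : kahler -> Q := \pi_(Quotient.quot varpi_submod)%qT.

Lemma classQ_eq w w' : classQ w = classQ w' <-> w - w' \in varpi_submod.
Proof.
rewrite /classQ Quotient.idealrBE; split=> [->|/eqP//]; exact: eqxx.
Qed.

Lemma classQ_surj q : exists w, classQ w = q.
Proof. by exists (repr q); rewrite /classQ reprK. Qed.

Fact classQ_zmod : zmod_morphism classQ.
Proof. exact: (raddfB \pi_(Quotient.quot varpi_submod)%qT). Qed.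

Definition scaleQ (c : F) (q : Q) : Q := classQ (c *: repr q).

Lemma scaleQE c w : scaleQ c (classQ w) = classQ (c *: w).
Proof.
by apply/classQ_eq; rewrite -scalerBr rpredZ //; apply/classQ_eq; exact: reprK.
Qed.

Fact scaleQA c d q : scaleQ c (scaleQ d q) = scaleQ (c * d) q.
Proof. by have [w <-] := classQ_surj q; rewrite !scaleQE scalerA. Qed.
Fact scale1Q : left_id 1 scaleQ.
Proof. by move=> q; have [w <-] := classQ_surj q; rewrite scaleQE scale1r. Qed.
Lemma classQD u v : classQ (u + v) = classQ u + classQ v.
Proof. exact: (raddfD \pi_(Quotient.quot varpi_submod)%qT). Qed.
Fact scaleQDr : right_distributive scaleQ +%R.
Proof.
move=> c p q; have [u <-] := classQ_surj p; have [v <-] := classQ_surj q.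
by rewrite -classQD !scaleQE scalerDr classQD.
Qed.
Fact scaleQDl q : {morph scaleQ^~ q : c d / c + d}.
Proof.
by move=> c d; have [u <-] := classQ_surj q; rewrite !scaleQE scalerDl classQD.
Qed.
HB.instance Definition _ :=
  GRing.Zmodule_isLmodule.Build F Q scaleQA scale1Q scaleQDr scaleQDl.

Fact classQ_is_linear : linear classQ.
Proof. by move=> c u v; rewrite classQD -scaleQE. Qed.
HB.instance Definition _ :=
  GRing.isLinear.Build F kahler Q _ classQ classQ_is_linear.

Lemma classQ_dz : classQ dz = classQ (rmulO dtheta (evenS (zpow F a) * theta)).
Proof.
apply/classQ_eq/varpi_submodP; exists 1.
by apply: eq_kahler; rewrite /= mulr1.
Qed.

Lemma classQ_dz_theta : classQ (rmulO dz theta) = 0.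
Proof.
rewrite -(linear0 classQ); apply/classQ_eq/varpi_submodP; exists theta.
by apply: eq_kahler; apply: eq_superlaurent; rewrite /=; ring.
Qed.

Definition dQ : superlaurent -> Q := classQ \o diff.
HB.instance Definition _ := GRing.Linear.on dQ.

(* sum_k ([dz] z^k u_k + [dtheta] z^k v_k) *)
Definition normal_form (uv : K * K) : Q :=
  classQ (rmulO dz (evenS uv.1) + rmulO dtheta (evenS uv.2)).

Lemma normal_formE p : normal_form p = classQ (evenS p.1, evenS p.2).
Proof.
by congr classQ; apply: eq_kahler; rewrite /= mul1r mul0r ?addr0 ?add0r.
Qed.

Fact normal_form_is_linear : linear normal_form.
Proof.
move=> c p q; rewrite !normal_formE -classQ_is_linear.
by congr classQ; apply: eq_kahler; apply: eq_superlaurent;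
  rewrite /= ?scaler0 ?addr0.
Qed.
HB.instance Definition _ :=
  GRing.isLinear.Build F (K * K)%type Q _ normal_form normal_form_is_linear.

Lemma normal_form_class (f g : V) :
  classQ (f, g) = normal_form (even_part f + zpow F (- a) * odd_part g, even_part g).
Proof.
rewrite normal_formE; apply/classQ_eq/varpi_submodP.
exists (SuperLaurent (- (zpow F (- a) * odd_part g)) (odd_part f)).
have za : zpow F a * zpow F (- a) = 1 by rewrite -zpowD subrr.
apply: eq_kahler; apply: eq_superlaurent; rewrite /=; try ring.
transitivity (zpow F a * zpow F (- a) * odd_part g); last by ring.
by rewrite za; ring.
Qed.

Lemma normal_form_inj : injective normal_form.
Proof.
suff nf0 p : normal_form p = 0 -> p = 0 by exact: raddf_inj nf0.
case: p => u v; rewrite normal_formE -(linear0 classQ).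
move=> /classQ_eq; rewrite subr0 => /varpi_submodP[h wh].
have uE : u = even_part h.
  by have /= -> := congr1 (fun w : kahler => even_part w.1) wh; ring.
have vE : v = 0.
  by have /= -> := congr1 (fun w : kahler => even_part w.2) wh; ring.
have hE : zpow F a * even_part h = 0.
  have /= E := congr1 (fun w : kahler => odd_part w.2) wh.
  by rewrite -oppr0 [X in - X]E; ring.
have -> : u = zpow F (- a) * (zpow F a * even_part h).
  by rewrite mulrA -zpowD addNr mul1r.
by rewrite hE mulr0 vE.
Qed.

Lemma normal_form_exists_unique q : exists! uv, normal_form uv = q.
Proof.
have [[f g] <-] := classQ_surj q; rewrite normal_form_class.
by eexists; split=> [|uv /normal_form_inj ->].
Qed.

(* Res is u_{-1} in the unique normal form (u, v) of q. *)
Definition Res (q : Q) : F^o := (xget 0 [set uv | normal_form uv = q]).1 (-1).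

Lemma Res_normal_form u v : Res (normal_form (u, v)) = u (-1).
Proof.
rewrite /Res; case: xgetP => [uv _ /normal_form_inj -> //|].
by move=> /(_ (u, v))/(_ erefl).
Qed.

Fact Res_is_scalar : scalar Res.
Proof.
move=> c p q; have [[u v] [<- _]] := normal_form_exists_unique p.
have [[u' v'] [<- _]] := normal_form_exists_unique q.
by rewrite -linearP !Res_normal_form.
Qed.
HB.instance Definition _ := GRing.isLinear.Build F Q F^o _ Res Res_is_scalar.

Definition has_parityQ (p : bool) (q : Q) : Prop :=
  exists2 w, has_parityO p w & classQ w = q.

Definition im_d : {pred Q} := fun q => `[< range dQ q >].

Lemma dQ_im_d f : dQ f \in im_d.
Proof. by apply/asboolP; exists f. Qed.

Fact im_d_submod : submod_closed im_d.
Proof.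
split; first by apply/asboolP; exists 0; rewrite ?linear0.
move=> c p q /asboolP[f _ <-] /asboolP[g _ <-].
by rewrite -linearP; exact: dQ_im_d.
Qed.
HB.instance Definition _ := GRing.isSubmodClosed.Build F Q im_d im_d_submod.

Record Q' := InImD { Q'val :> Q; _ : Q'val \in im_d }.
HB.instance Definition _ := [isSub for Q'val].
HB.instance Definition _ := [Choice of Q' by <:].
HB.instance Definition _ := [SubChoice_isSubLmodule of Q' by <:].

Definition dQ' (f : V) : Q' := InImD (dQ_im_d f).

Definition super_antisymmetric (B : Q' -> Q' -> F^o) : Prop :=
  forall (p q : bool) (X Y : Q'), has_parityQ p X -> has_parityQ q Y ->
    B X Y = - (-1) ^+ (p * q) * B Y X.

End Quotient.
End SuperLaurent.

Definition nondegenerate_pairing (F : fieldType) (U : lmodType F)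
    (B : {biscalar U}) : Prop :=
  (forall x, (forall y, B x y = 0) -> x = 0) /\
  (forall y, (forall x, B x y = 0) -> y = 0).

Definition super_symplectic (F : fieldType) (a : int) (B : {biscalar (Q' F a)}) :
  Prop := super_antisymmetric B /\ nondegenerate_pairing B.

Definition exact_at (F : fieldType) (U V W : lmodType F)
    (f : {linear U -> V}) (g : {linear V -> W}) : Prop :=
  range f = [set y | g y = 0].

(* Main.v *)
(** In the normal form [(u, v)] of [Q], the class of [df] is [(f0', f1)] for
    [f = f0 + theta f1], which gives exactness: in characteristic 0 the kernel of
    [u |-> u'] is the constants, and its image is the series with [u_(-1) = 0].
    The residue of [df g] is
      [res (f0' g0) + res (z^(-a) f1 g1)],
    where [res (f0' g0)] is antisymmetric because a derivative has no residue.
    Hence the pairing depends only on [df] and [dg]; it is antisymmetric on the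
    even part and symmetric on the odd part, which are orthogonal, and testing
    against monomials shows that it is non-degenerate. *)
Require Import Defs.
From HB Require Import structures.
From mathcomp Require Import all_boot all_order all_algebra.
From mathcomp Require Import all_classical reals complex.
From mathcomp Require Import zify ring.

Set Implicit Arguments.
Unset Strict Implicit.
Unset Printing Implicit Defensive.

Import Order.TTheory GRing.Theory Num.Theory.

Local Open Scope classical_set_scope.
Local Open Scope ring_scope.

Lemma pchar0_intr_eq0 (F : fieldType) (k : int) :
  [pchar F] =i pred0 -> (k%:~R == 0 :> F) = (k == 0).
Proof.
by move=> /pcharf0P F0; case: k => n; rewrite ?NegzE ?mulrNz ?oppr_eq0 -pmulrn F0.
Qed.

(** * Derivatives and residues of Laurent series *)

Section Laurent.
Variable F : fieldType.
Implicit Types u v : laurent F.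

Lemma coef_mul u v n :
  (u * v : laurent F) n = \sum_(i \in [set: int]) (u i * v (n - i) : F).
Proof. by []. Qed.

Lemma coef_derivL u k : derivL u k = (k + 1)%:~R * u (k + 1).
Proof. by []. Qed.

Lemma res_derivL u : derivL u (-1) = 0.
Proof. by rewrite coef_derivL addNr mul0r. Qed.

Lemma derivL1 : derivL 1 = 0 :> laurent F.
Proof.
apply/laurentP => k; rewrite coef_derivL coefL0 /=.
by case: eqP => [->|_]; rewrite ?mul0r ?mulr0.
Qed.

(** Integration by parts, checked directly on the two coefficient sums. *)
Lemma res_derivL_mulC u v :
  (derivL u * v : laurent F) (-1) = - (derivL v * u : laurent F) (-1).
Proof.
have sumrN (f : int -> F) :
    - \sum_(i \in [set: int]) f i = \sum_(i \in [set: int]) - f i.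
  by rewrite -mulN1r mulr_fsumr; apply: eq_fsbigr => i _; rewrite mulN1r.
(* The reflection $i\mapsto-2-i$ exchanges the indices $i+1$ and $-1-i$ and flips the sign of the
   factor $i+1$. *)
rewrite !coef_mul [RHS]sumrN (reindex_fsbigT (fun i : int => - 2 - i)); last first.
  by exists (fun i => - 2 - i) => i; lia.
apply: eq_fsbigr => i _; rewrite !coef_derivL.
have -> : - 2 - i + 1 = - 1 - i :> int by lia.
have -> : - 1 - (- 2 - i) = i + 1 :> int by lia.
have -> : - 1 - i = - (i + 1) :> int by lia.
by rewrite mulrNz; ring.
Qed.

(** Multiplication by $z^k$ shifts coefficients, so these residues run through all coefficients of
    [u]. *)
Lemma laurent_eq0_coef u : (forall k, (zpow F k * u : laurent F) (-1) = 0) -> u = 0.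
Proof.
move=> u0; apply/laurentP => n; rewrite coefL0 -[RHS](u0 (- n - 1)).
by rewrite coef_mul_zpow; congr (u _); lia.
Qed.

Hypothesis F0 : [pchar F] =i pred0.

Lemma derivL_eq0 u : derivL u = 0 -> u = (u 0 : F) *: 1.
Proof.
move=> du; apply/laurentP => k.
rewrite coefLZ /=; case: (eqVneq k 0) => [->|k0]; first by rewrite mulr1.
have /eqP := congr1 (fun w : laurent F => w (k - 1)) du.
rewrite coef_derivL subrK coefL0 mulf_eq0 pchar0_intr_eq0 // (negPf k0) /=.
by move=> /eqP ->; rewrite mulr0.
Qed.

Lemma derivL_surj u : u (-1) = 0 -> exists v, derivL v = u.
Proof.
(* Termwise integration $z^{k-1}\mapsto z^k/k$; at $k=0$ the convention $0^{-1}=0$ makes the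
   constant term $0$. *)
move=> u0; have bb : (fun k => k%:~R^-1 * u (k - 1) : F^o) \in @bounded_below F.
  have [m hu] := laurent_bound u; apply/bounded_belowP; exists m => k km.
  by rewrite [u _]hu ?mulr0 //; lia.
exists (Laurent bb); apply/laurentP => k; rewrite coef_derivL /= addrK.
have [->|k0] := eqVneq k (-1); first by rewrite u0 !mulr0.
by rewrite mulVKf // pchar0_intr_eq0 //; lia.
Qed.

End Laurent.

(** * The map [dQ] and the residue pairing *)

Section Pairing.
Variables (F : fieldType) (a : int).
Local Notation V := (superlaurent F).
Implicit Types f g : V.

(** The odd part of [d_z f] dies because $[dz]\theta=0$, and [d_theta f] has no odd part, so no
    power $z^{-a}$ appears. *)
Lemma dQE f : dQ a f = normal_form a (derivL (even_part f), odd_part f).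
Proof.
rewrite /dQ /= [diff f]surjective_pairing normal_form_class.
by rewrite /= !mul1r !mul0r !addr0 mulr0 addr0 add0r.
Qed.

Lemma dQ_eq f g : dQ a f = dQ a g ->
  derivL (even_part f) = derivL (even_part g) /\ odd_part f = odd_part g.
Proof. by rewrite !dQE => /normal_form_inj/pair_equal_spec. Qed.

Lemma Res_dQ f : Res (dQ a f) = 0.
Proof. by rewrite dQE Res_normal_form res_derivL. Qed.

Lemma range_Res : range (@Res F a) = [set: F].
Proof.
rewrite -subTset => c _; exists (normal_form a ((c : F) *: zpow F (-1), 0)) => //.
by rewrite Res_normal_form coefLZ mulr1.
Qed.

Lemma constS_inj : injective (@constS F).
Proof.
by move=> c d /(congr1 (fun f : V => even_part f 0)) /(mulIf (oner_neq0 F)).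
Qed.

Definition pairing f g : F^o := Res (classQ a (rmulO (diff f) g)).

(** The second residue comes from $[d\theta]\theta=[dz]z^{-a}$. *)
Lemma pairingE f g : pairing f g =
  (derivL (even_part f) * even_part g : laurent F) (-1) +
  (zpow F (- a) * (odd_part f * odd_part g) : laurent F) (-1).
Proof.
have diffM : rmulO (diff f) g = (d_z f * g, evenS (odd_part f) * g).
  by apply: eq_kahler; rewrite /= mul1r mul0r ?addr0 ?add0r.
rewrite /pairing diffM normal_form_class Res_normal_form coefLD.
by congr (_ + coefL (_ * _) (-1)); rewrite /= mul0r addr0.
Qed.

Lemma pairingDl c f f' g : pairing (c *: f + f') g = c * pairing f g + pairing f' g.
Proof.
rewrite /pairing; have -> : rmulO (diff (c *: f + f')) g =
    c *: rmulO (diff f) g + rmulO (diff f') g.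
  by rewrite linearP; apply: eq_kahler; rewrite /= mulrDl scalerAl.
by rewrite !linearP.
Qed.

Lemma pairingDr c f g g' : pairing f (c *: g + g') = c * pairing f g + pairing f g'.
Proof. by rewrite /pairing rmulO_is_linear !linearP. Qed.

(** The pairing descends to [Q']: integration by parts trades [even_part g] for its derivative,
    which [dQ a g] determines. *)
Lemma eq_pairing f f' g g' :
  dQ a f = dQ a f' -> dQ a g = dQ a g' -> pairing f g = pairing f' g'.
Proof.
move=> /dQ_eq[df f1] /dQ_eq[dg g1]; rewrite !pairingE df f1 g1.
by rewrite res_derivL_mulC dg -res_derivL_mulC.
Qed.

(** An arbitrary choice, harmless by [eq_pairing]; the default [0] is never reached, since [X] lies
    in the image. *)
Definition primitive (X : Q' F a) : V := xget 0 [set f | dQ a f = X].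

Lemma primitiveK X : dQ a (primitive X) = X.
Proof.
rewrite /primitive; case: xgetP => [f _ //|noprim].
by have /asboolP[f _ /noprim] := valP X.
Qed.

Definition pairingQ (X Y : Q' F a) : F^o := pairing (primitive X) (primitive Y).

Lemma pairingQE f g : pairingQ (dQ' a f) (dQ' a g) = pairing f g.
Proof. by apply: eq_pairing; rewrite primitiveK. Qed.

Lemma dQ'_surj (X : Q' F a) : exists f, dQ' a f = X.
Proof. by exists (primitive X); apply/val_inj/primitiveK. Qed.

Lemma dQ'_is_linear : linear (@dQ' F a).
Proof. by move=> c f g; apply/val_inj; exact: linearP. Qed.

Fact pairingQ_bilinear :
  bilinear_for ( *%R : GRing.Scale.law F F^o) ( *%R : GRing.Scale.law F F^o) pairingQ.
Proof.
split=> [Z c X Y | Z c X Y];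
  have [f <-] := dQ'_surj X; have [g <-] := dQ'_surj Y; have [h <-] := dQ'_surj Z.
  by rewrite -dQ'_is_linear !pairingQE pairingDl.
by rewrite -dQ'_is_linear !pairingQE pairingDr.
Qed.
HB.instance Definition _ := bilinear_isBilinear.Build F (Q' F a) (Q' F a) F^o
  *%R *%R pairingQ pairingQ_bilinear.

(** In the normal form $[dz]z^k$ is even and $[d\theta]z^k$ is odd, so a homogeneous class has only
    one component. *)
Lemma parity_dQ p f : has_parityQ p (dQ a f) ->
  if p then derivL (even_part f) = 0 else odd_part f = 0.
Proof.
case=> -[w1 w2] [/= p1 p2]; rewrite normal_form_class dQE.
move=> /normal_form_inj/pair_equal_spec[<- <-].
by case: p p1 p2 => /= [-> ->|_ ->]; rewrite ?mulr0 ?addr0.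
Qed.

Lemma pairingQ_antisym : super_antisymmetric pairingQ.
Proof.
move=> p q X Y; have [f <-] := dQ'_surj X; have [g <-] := dQ'_surj Y.
rewrite !pairingQE !pairingE => /parity_dQ pf /parity_dQ qg.
(* In the mixed cases parity kills only derivatives, so one residue must be integrated by parts
   before it vanishes. *)
rewrite [odd_part f * _]mulrC; case: p q pf qg => [] [] pf qg; rewrite /= in pf qg.
- by rewrite pf qg !mul0r add0r expr1 opprK mul1r.
- by rewrite (res_derivL_mulC (even_part g)) pf qg !(mul0r, mulr0) oppr0 addr0 mulr0.
- by rewrite (res_derivL_mulC (even_part f)) pf qg !(mul0r, mulr0) oppr0 addr0 mulr0.
- by rewrite (res_derivL_mulC (even_part f)) pf mulr0 mulr0 !addr0 expr0 mulN1r.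
Qed.

Lemma pairing_even f u :
  pairing f (SuperLaurent u 0) = (u * derivL (even_part f) : laurent F) (-1).
Proof. by rewrite pairingE !mulr0 coefL0 addr0 mulrC. Qed.

Lemma pairing_odd f u : pairing f (SuperLaurent 0 u) =
  (u * zpow F (- a) * odd_part f : laurent F) (-1).
Proof.
rewrite pairingE mulr0 coefL0 add0r.
by congr (coefL _ (-1)); rewrite /=; ring.
Qed.

Lemma pairing_nondegl f : (forall g, pairing f g = 0) -> dQ a f = 0.
Proof.
move=> f0; rewrite dQE.
have -> : derivL (even_part f) = 0.
  by apply: laurent_eq0_coef => k; rewrite -pairing_even.
have -> : odd_part f = 0.
  apply: laurent_eq0_coef => k.
  (* The test element is $\theta z^{k+a}$, whose exponent compensates the factor $z^{-a}$. *)
  by rewrite -(addrK a k) zpowD -pairing_odd.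
exact: linear0.
Qed.

(** Antisymmetry without homogeneity, the sign being absorbed into the even part; it reduces right
    non-degeneracy to left. *)
Lemma pairing_swap f g :
  pairing f g = pairing (SuperLaurent (- even_part g) (odd_part g)) f.
Proof.
rewrite !pairingE res_derivL_mulC [even_part (SuperLaurent _ _)]/=.
by rewrite linearN mulNr coefLN [odd_part f * _]mulrC.
Qed.

Lemma pairingQ_nondeg : nondegenerate_pairing pairingQ.
Proof.
split=> X; have [f <-] := dQ'_surj X => f0; apply/val_inj/pairing_nondegl => g.
  by rewrite -pairingQE.
by rewrite pairing_swap -pairingQE.
Qed.

End Pairing.

(** * Exactness in characteristic 0 *)

Section Exactness.
Variables (F : fieldType) (a : int).
Hypothesis F0 : [pchar F] =i pred0.

Lemma exact_constS_dQ : exact_at (@constS F) (@dQ F a).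
Proof.
apply/seteqP; split=> [_ [c _ <-] | f] /=.
  by rewrite dQE /= linearZ /= derivL1 !scaler0; exact: linear0.
rewrite dQE -(linear0 (@normal_form F a)) => /normal_form_inj.
move=> /pair_equal_spec[df f1].
exists (even_part f 0) => //; apply: eq_superlaurent; rewrite /= ?scaler0 ?f1 //.
by rewrite [RHS]derivL_eq0.
Qed.

Lemma exact_dQ_Res : exact_at (@dQ F a) (@Res F a).
Proof.
apply/seteqP; split=> [_ [f _ <-] | q] /=; first exact: Res_dQ.
have [[u v] [<- _]] := normal_form_exists_unique q.
rewrite Res_normal_form => /(derivL_surj F0)[w <-].
by exists (SuperLaurent w v); rewrite // dQE.
Qed.

End Exactness.

Theorem proposition2p26 (R : realType) (a : int) :
  [/\ injective (@constS R[i]),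
      exact_at (@constS R[i]) (@dQ R[i] a),
      exact_at (@dQ R[i] a) (@Res R[i] a)
    & range (@Res R[i] a) = [set: R[i]]] /\
  exists B : {biscalar (Q' R[i] a)},
    super_symplectic B /\
    forall f g : superlaurent R[i],
      B (dQ' a f) (dQ' a g) = Res (classQ a (rmulO (diff f) g)).
Proof.
split; last first.
  exists (@pairingQ R[i] a); split; last exact: pairingQE.
  by split; [exact: pairingQ_antisym | exact: pairingQ_nondeg].
split; [exact: constS_inj | | | exact: range_Res].
- exact/exact_constS_dQ/pchar_num.
- exact/exact_dQ_Res/pchar_num.
Qed.
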